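(* Let $T$ be a 4-tangle (shadow diagram), let $n\ge0$, and let $T_n$ be the $n$-fold concatenation of $T$ with itself, with bracket vector $A_n=\big[a_1^{(n)},\dots,a_{14}^{(n)}\big]^\intercal$, i.e. $\langle T_n\rangle=\sum_{i=1}^{14}a_i^{(n)}\langle g_i\rangle$ with $a_i^{(n)}\in\mathbb{Z}[x]$. Let $$\overline{X}=\left[x^4,x^3,x^3,x^3,x^2,x^2,x^2,x^2,x,x^2,x^2,x,x,x\right]^\intercal.$$ Then the bracket polynomial of the closure of $T_n$ is $$\langle\overline{T_n}\rangle=A_n\cdot\overline{X},$$ where $\cdot$ denotes the dot product.
   Context: A 4-tangle (shadow) is a planar diagram in a rectangle, made of finitely many arcs and closed curves immersed with only transverse double points (crossings, with no over/under information), having four endpoints $1,2,3,4$ on the top side and four endpoints $1',2',3',4'$ on the bottom side, both numbered from left to right. Bracket: $\langle\cdot\rangle$ is defined on shadow diagrams by (K1) $\langle\bigcirc\rangle=x$ for a single crossingless closed curve; (K2) $\langle\bigcirc\sqcup D'\rangle=x\langle D'\rangle$ for a disjoint crossingless closed curve; (K3) for any crossing of a diagram $D$, $\langle D\rangle=\langle D'\rangle+\langle D''\rangle$, where $D',D''$ are obtained from $D$ by replacing that crossing by its two planar smoothings. For a diagram consisting only of closed curves, $\langle\cdot\rangle\in\mathbb{Z}[x]$. For a 4-tangle $T$, $\langle T\rangle$ is a unique $\mathbb{Z}[x]$-linear combination $\sum_{i=1}^{14}a_i\langle g_i\rangle$ in the free $\mathbb{Z}[x]$-module on the 14 crossingless,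 loop-free 4-tangles (up to planar isotopy) $g_1,\dots,g_{14}$, the basis of the Kauffman diagram monoid $\mathcal{K}_4$. These are the planar diagrams given by the following pairings of endpoints ($ij$ means endpoints $i$ and $j$ are joined): $g_1: 11',22',33',44'$; $g_2: 12,1'2',33',44'$; $g_3: 11',23,2'3',44'$; $g_4: 11',22',34,3'4'$; $g_5: 23,1'2',13',44'$; $g_6: 12,2'3',31',44'$; $g_7: 34,2'3',11',24'$; $g_8: 23,3'4',11',42'$; $g_9: 14,23,1'2',3'4'$; $g_{10}: 14,23,1'4',2'3'$; $g_{11}: 12,34,1'2',3'4'$; $g_{12}: 12,34,1'4',2'3'$; $g_{13}: 34,1'2',13',24'$; $g_{14}: 12,3'4',31',42'$. Concatenation: $TT'$ is the 4-tangle formed by placing $T$ directly above $T'$ and connecting the bottom endpoints of $T$ to the corresponding top endpoints of $T'$ by non-crossing planar arcs. For $n\ge1$, $T_n=TT\cdots T$ ($n$ copies), and $T_0=g_1$ (the identity tangle), so that $A_0=[1,0,\dots,0]^\intercal$. Closure: $\overline{T}$ is the closed diagram obtained from a 4-tangle $T$ by joining, outside the rectangle and without introducing any crossing, each top endpoint $i$ to the corresponding bottom endpoint $i'$, for $i=1,2,3,4$. *)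

(* Defs.v *)
From mathcomp Require Import all_boot all_order all_algebra all_fingroup.
Set Implicit Arguments.
Unset Strict Implicit.
Unset Printing Implicit Defensive.
Import GRing.Theory.
Local Open Scope ring_scope.

(* A plane diagram is encoded by its combinatorial map.  A dart is an edge end;
   [edge] exchanges the two ends of an edge and [node] sends a dart to the next
   one counterclockwise around its vertex.  The vertices have degree
     - 4: the crossings;
     - 2: regular points of a curve, so that a crossingless closed curve is
       representable and gluing or smoothing never has to delete a vertex;
     - 1: the endpoints on the boundary, labelled by [B].
   The relative position of the connected components of a diagram is not
   recorded. *)
Record shadow (B : finType) := Shadow {
  dart : finType;
  edge : {ffun dart -> dart};
  node : {ffun dart -> dart};
  endp : B -> dart
}.

Definition diagram (B : finType) (D : shadow B) : Prop :=
  [/\ involutive (edge D),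
      forall d, edge D d != d,
      injective (endp D),
      forall d, (node D d == d) = (d \in codom (endp D))
    & forall d, iter 4 (node D) d = d].

Definition link (B : finType) (D : shadow B) : rel (dart D) :=
  [rel d e | (e == edge D d) || (e == node D d)].
Arguments link [B] D : rename.

Definition components (B : finType) (D : shadow B) : {set {set dart D}} :=
  [set [set e | connect (link D) d e] | d : dart D].

Definition crossing (B : finType) (D : shadow B) : pred (dart D) :=
  [pred d | node D (node D d) != d].
Arguments crossing [B] D : rename.

(* Around a crossing with cyclic dart order d, d1, d2, d3 this joins d with d1
   and d2 with d3; the other smoothing is [smooth D (node D d)]. *)
Definition smooth (B : finType) (D : shadow B) (d : dart D) : shadow B :=
  Shadow (edge D) [ffun e => tperm d (node D (node D d)) (node D e)] (endp D).
Arguments smooth [B] D d : rename.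

(* Apply <D> = <D'> + <D''> until no crossing is left, then [v]. *)
Fixpoint resolve (B : finType) (M : nmodType) (v : shadow B -> M) (k : nat)
    (D : shadow B) : M :=
  if k is k'.+1 then
    if [pick d | crossing D d] is Some d
    then resolve v k' (smooth D d) + resolve v k' (smooth D (node D d))
    else v D
  else v D.

Definition skein (B : finType) (M : nmodType) (v : shadow B -> M)
    (D : shadow B) : M := resolve v #|crossing D| D.

Section Skein.
Variables (B : finType) (M : nmodType) (v : shadow B -> M).
Implicit Type D : shadow B.

Definition period4 D := forall d, iter 4 (node D) d = d.

Lemma node_inj D : period4 D -> injective (node D).
Proof. by move=> q x y e; rewrite -(q x) -(q y) /= e. Qed.

Lemma crossing_def D d : crossing D d = (node D (node D d) != d).
Proof. by []. Qed.

Lemma crossing_node D d : period4 D -> crossing D (node D d) = crossing D d.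
Proof. by move=> q; rewrite !crossing_def (inj_eq (node_inj q)). Qed.

Lemma smooth_opp D d : period4 D -> smooth D (node D (node D d)) = smooth D d.
Proof. by move=> q; have /= := q d; rewrite /smooth => ->; rewrite tpermC. Qed.

Definition vertex D d :=
  [:: d; node D d; node D (node D d); node D (node D (node D d))].
Arguments vertex D d : clear implicits.

Lemma smoothE D d e : period4 D -> crossing D d -> e \in vertex D d ->
  node (smooth D d) (node (smooth D d) e) = e.
Proof.
move=> q cd; have q4 := q d; have I := node_inj q; rewrite /= in q4.
rewrite crossing_def in cd.
have c1 : node D (node D (node D d)) != node D d by rewrite (inj_eq I).
have n1 : d != node D d by apply: contra cd => /eqP h; rewrite -!h.
have n2 : d != node D (node D (node D d)).
  by apply: contra n1 => /eqP h; rewrite {2}h q4.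
have n3 : node D (node D d) != node D d by rewrite (inj_eq I) eq_sym.
have n4 : node D (node D d) != node D (node D (node D d)).
  by rewrite (inj_eq I) eq_sym.
have T1 : tperm d (node D (node D d)) (node D d) = node D d by rewrite tpermD.
have T3 : tperm d (node D (node D d)) (node D (node D (node D d))) =
  node D (node D (node D d)) by rewrite tpermD.
by rewrite !inE => /or4P[] /eqP ->; rewrite !ffunE /= ?q4 ?(T1, T3, tpermL, tpermR)
  ?q4 ?(T1, T3, tpermL, tpermR).
Qed.

Lemma vertex_node D d e : period4 D -> (node D e \in vertex D d) = (e \in vertex D d).
Proof.
move=> q; have q4 := q d; have I := node_inj q; rewrite /= in q4.
by rewrite !inE -{1}q4 !(inj_eq I) orbC -!orbA.
Qed.

Lemma smoothD D d e : period4 D -> e \notin vertex D d ->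
  node (smooth D d) e = node D e.
Proof.
move=> q; rewrite -(vertex_node _ _ q) !inE !negb_or => /and4P[h1 _ h2 _].
by rewrite ffunE tpermD // eq_sym.
Qed.

Lemma period4_smooth D d : period4 D -> period4 (smooth D d).
Proof.
move=> q e; have [cd|] := boolP (crossing D d); last first.
  rewrite crossing_def negbK => /eqP cd.
  suff E : node (smooth D d) = node D by rewrite E; exact: q.
  by apply/ffunP=> x; rewrite ffunE cd tperm1 perm1.
have [i|i] := boolP (e \in vertex D d); first by rewrite /= !(smoothE q cd i).
by rewrite /= !(smoothD q) ?vertex_node //; exact: (q e).
Qed.

Lemma crossing_smooth D d e : period4 D -> crossing D d ->
  crossing (smooth D d) e = crossing D e && (e \notin vertex D d).
Proof.
move=> q cd; have [i|i] := boolP (e \in vertex D d); rewrite !crossing_def.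
  by rewrite (smoothE q cd i) eqxx andbF.
by rewrite !(smoothD q) ?vertex_node // andbT.
Qed.

Lemma card_smooth D d : period4 D -> crossing D d ->
  (#|crossing (smooth D d)| < #|crossing D|)%N.
Proof.
move=> q cd; apply: proper_card; apply/properP; split.
  apply/subsetP => e h; have {h} : crossing (smooth D d) e := h.
  by rewrite (crossing_smooth e q cd) => /andP[].
exists d => //; apply: (_ : is_true (~~ crossing (smooth D d) d)).
by rewrite (crossing_smooth d q cd) !inE eqxx andbF.
Qed.

Lemma resolve_fuel k1 k2 D : period4 D -> (#|crossing D| <= k1)%N ->
  (#|crossing D| <= k2)%N -> resolve v k1 D = resolve v k2 D.
Proof.
have no : forall D', period4 D' -> (#|crossing D'| <= 0)%N ->
  forall k, resolve v k D' = v D'.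
  move=> D' q' h [|k] //=; case: pickP => // x cx.
  by move: h; rewrite leqn0 => /eqP/card0_eq/(_ x); rewrite -topredE /= cx.
elim: k1 k2 D => [|k1 IH] [|k2] D q h1 h2 //.
- by rewrite !no.
- by rewrite !no.
rewrite /=; case: pickP => // x cx.
have lt y n : crossing D y -> (#|crossing D| <= n.+1)%N ->
    (#|crossing (smooth D y)| <= n)%N.
  by move=> cy h; rewrite -ltnS; apply: leq_trans h; apply: card_smooth.
have cnx : crossing D (node D x) by rewrite crossing_node.
by congr (_ + _); apply: IH; first [exact: lt | exact: period4_smooth].
Qed.

Lemma smoothC D c d : period4 D -> d \notin vertex D c ->
  smooth (smooth D c) d = smooth (smooth D d) c.
Proof.
move=> q h.
have h' : c \notin vertex D d.
  apply: contra h; have q4 := q d; rewrite /= in q4.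
  by rewrite !inE => /or4P[] /eqP ->; rewrite ?q4 eqxx ?orbT.
have E1 : node (smooth D c) (node (smooth D c) d) = node D (node D d).
  by rewrite !(smoothD q) ?vertex_node.
have E2 : node (smooth D d) (node (smooth D d) c) = node D (node D c).
  by rewrite !(smoothD q) ?vertex_node.
rewrite /smooth in E1 E2 *; rewrite E1 E2 /=; congr Shadow; apply/ffunP => e.
rewrite !ffunE -!permM.
suff -> : (tperm c (node D (node D c)) * tperm d (node D (node D d)) =
           tperm d (node D (node D d)) * tperm c (node D (node D c)))%g by [].
apply/commgP; apply/conjg_fixP; rewrite tpermJ.
have k z : z \in vertex D c -> tperm d (node D (node D d)) z = z.
  move=> zi; rewrite tpermD //; apply: contraNneq h.
    by move=> ->.
  by move=> E; rewrite -(vertex_node _ _ q) -(vertex_node _ _ q) E.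
by rewrite !k // !inE eqxx ?orbT.
Qed.

(* The recursion relation holds at every crossing, not only at those picked. *)
Lemma skein_crossing D d : period4 D -> crossing D d ->
  skein v D = skein v (smooth D d) + skein v (smooth D (node D d)).
Proof.
have step D' c k : period4 D' -> crossing D' c -> (#|crossing D'| <= k.+1)%N ->
    resolve v k (smooth D' c) = skein v (smooth D' c).
  move=> q' c' h; apply: resolve_fuel => //; first exact: period4_smooth.
  by rewrite -ltnS; apply: leq_trans h; apply: card_smooth.
have [m] := ubnP #|crossing D|; elim: m D d => // m IH D d; rewrite ltnS => hm q cd.
rewrite {1}/skein.
case E : #|crossing D| => [|k].
  by move/card0_eq: E => /(_ d); rewrite -topredE /= cd.
rewrite /=; case: pickP => [c cc|/(_ d)]; last by rewrite cd.
have E' : (#|crossing D| <= k.+1)%N by rewrite E.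
rewrite !step // ?crossing_node //.
have [i|i] := boolP (d \in vertex D c).
  have q4 := q c; rewrite /= in q4.
  move: i; rewrite !inE => /or4P[] /eqP ->; rewrite ?q4 ?smooth_opp //.
  - by rewrite addrC.
  - by rewrite addrC.
have nd : node D d \notin vertex D c by rewrite vertex_node.
have i' : d \notin vertex D (node D c).
  apply: contra i; have q4 := q c; rewrite /= in q4.
  by rewrite !inE q4 => /or4P[] ->; rewrite ?orbT.
have nd' : node D d \notin vertex D (node D c) by rewrite vertex_node.
have ic : c \notin vertex D d.
  apply: contra i; have q4 := q d; rewrite /= in q4.
  by rewrite !inE => /or4P[] /eqP ->; rewrite ?q4 eqxx ?orbT.
have inc : c \notin vertex D (node D d).
  apply: contra ic; have q4 := q d; rewrite /= in q4.
  by rewrite !inE q4 => /or4P[] ->; rewrite ?orbT.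
have cnc : crossing D (node D c) by rewrite crossing_node.
have cnd : crossing D (node D d) by rewrite crossing_node.
have lt x : crossing D x -> (#|crossing (smooth D x)| < m)%N.
  by move=> cx; apply: leq_trans hm; apply: card_smooth.
rewrite (IH (smooth D c) d) ?lt ?crossing_smooth ?cd //;
  last exact: period4_smooth.
rewrite (IH (smooth D (node D c)) d) ?lt ?crossing_smooth ?cd //;
  last exact: period4_smooth.
rewrite (IH (smooth D d) c) ?lt ?crossing_smooth ?cc //;
  last exact: period4_smooth.
rewrite (IH (smooth D (node D d)) c) ?lt ?crossing_smooth ?cc //;
  last exact: period4_smooth.
rewrite !smoothD //.
rewrite (smoothC q i) (smoothC q nd) (smoothC q i') (smoothC q nd').
exact: addrACA.
Qed.
End Skein.

(* In a crossingless diagram the components are the curves. *)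
Definition loops (B : finType) (D : shadow B) : nat :=
  #|[set C in components D | [disjoint C & codom (endp D)]]|.

Definition pairing (B : finType) (D : shadow B) : {set {set B}} :=
  [set [set c | connect (link D) (endp D b) (endp D c)] | b : B].

Definition closed_bracket (D : shadow void) : {poly int} :=
  skein (fun S => 'X^(loops S)) D.

(* A crossingless, loop-free tangle is determined up to planar isotopy by its
   pairing of the endpoints, so the bracket of a tangle is an element of the
   free Z[x]-module on the pairings. *)
Definition tangle_bracket (B : finType) (T : shadow B) :
    {ffun {set {set B}} -> {poly int}^o} :=
  skein (fun S => [ffun p => if p == pairing S then 'X^(loops S) else 0]) T.

(* Join the endpoints b and sigma b, for sigma an involution of the labels; the
   fixed points of sigma remain endpoints, and are relabelled by r.  For a
   general permutation sigma, the endpoints in each cycle are merged into one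
   vertex. *)
Definition splice (B B' : finType) (D : shadow B) (sigma : B -> B)
    (r : B' -> B) : shadow B' :=
  Shadow (edge D)
    [ffun d => if [pick b | endp D b == d] is Some b then endp D (sigma b)
               else node D d]
    (fun b => endp D (r b)).

Definition disjoint_union (B B' : finType) (D : shadow B) (D' : shadow B') :
    shadow (B + B')%type :=
  @Shadow _ (dart D + dart D')%type
    [ffun d => match d with inl u => inl (edge D u) | inr u => inr (edge D' u) end]
    [ffun d => match d with inl u => inl (node D u) | inr u => inr (node D' u) end]
    (fun b => match b with inl c => inl (endp D c) | inr c => inr (endp D' c) end).

(* [inl i] is the (i+1)-st top endpoint, [inr i] the (i+1)-st bottom one. *)
Definition endpoint : finType := ('I_4 + 'I_4)%type.

Definition t1 : endpoint := inl (@Ordinal 4 0 isT).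
Definition t2 : endpoint := inl (@Ordinal 4 1 isT).
Definition t3 : endpoint := inl (@Ordinal 4 2 isT).
Definition t4 : endpoint := inl (@Ordinal 4 3 isT).
Definition b1 : endpoint := inr (@Ordinal 4 0 isT).
Definition b2 : endpoint := inr (@Ordinal 4 1 isT).
Definition b3 : endpoint := inr (@Ordinal 4 2 isT).
Definition b4 : endpoint := inr (@Ordinal 4 3 isT).

(* The outside of the rectangle becomes one vertex.  Around it, the
   counterclockwise order on the sphere is the clockwise order along the
   boundary of the rectangle. *)
Definition shrink_outside (T : shadow endpoint) : shadow void :=
  splice T (next [:: t1; t2; t3; t4; b4; b3; b2; b1]) (@of_void endpoint).

(* Euler's formula V + F = E + 2C; the faces are the cycles of node o edge. *)
Definition planar (T : shadow endpoint) : Prop :=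
  let M := shrink_outside T in
  (fcard (node M) predT + fcard (node M \o edge M) predT
   = fcard (edge M) predT + 2 * #|components M|)%N.

Definition tangle4 (T : shadow endpoint) : Prop := diagram T /\ planar T.

Definition concat (T T' : shadow endpoint) : shadow endpoint :=
  splice (disjoint_union T T')
    (fun b => match b with
              | inl (inr i) => inr (inl i)
              | inr (inl i) => inl (inr i)
              | _ => b
              end)
    (fun b => match b with inl i => inl (inl i) | inr i => inr (inr i) end).

Definition tangle_closure (T : shadow endpoint) : shadow void :=
  splice T (fun b => match b with inl i => inr i | inr i => inl i end)
    (@of_void endpoint).

Definition chords (s : seq (endpoint * endpoint)) : shadow endpoint :=
  Shadow [ffun b => (\prod_(p <- s) tperm p.1 p.2)%g b] [ffun b => b] id.

Definition g_chords : seq (seq (endpoint * endpoint)) :=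
  [:: [:: (t1, b1); (t2, b2); (t3, b3); (t4, b4)];
      [:: (t1, t2); (b1, b2); (t3, b3); (t4, b4)];
      [:: (t1, b1); (t2, t3); (b2, b3); (t4, b4)];
      [:: (t1, b1); (t2, b2); (t3, t4); (b3, b4)];
      [:: (t2, t3); (b1, b2); (t1, b3); (t4, b4)];
      [:: (t1, t2); (b2, b3); (t3, b1); (t4, b4)];
      [:: (t3, t4); (b2, b3); (t1, b1); (t2, b4)];
      [:: (t2, t3); (b3, b4); (t1, b1); (t4, b2)];
      [:: (t1, t4); (t2, t3); (b1, b2); (b3, b4)];
      [:: (t1, t4); (t2, t3); (b1, b4); (b2, b3)];
      [:: (t1, t2); (t3, t4); (b1, b2); (b3, b4)];
      [:: (t1, t2); (t3, t4); (b1, b4); (b2, b3)];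
      [:: (t3, t4); (b1, b2); (t1, b3); (t2, b4)];
      [:: (t1, t2); (b3, b4); (t3, b1); (t4, b2)]].

(* The list g_1, ..., g_14 is indexed from 0 here. *)
Definition g (i : 'I_14) : shadow endpoint := chords (nth [::] g_chords i).

(* [iterop] gives T_0 = g_1, T_1 = T and T_(n+1) = T T_n for n > 0. *)
Definition tangle_power (T : shadow endpoint) (n : nat) : shadow endpoint :=
  iterop n concat T (g ord0).

Definition is_bracket_vector (T : shadow endpoint) (A : 'cV[{poly int}]_14) :
    Prop :=
  tangle_bracket T = \sum_(i < 14) A i 0 *: tangle_bracket (g i).

Definition Xbar : 'cV[{poly int}]_14 :=
  \col_(i < 14)
    nth 0 [:: 'X^4; 'X^3; 'X^3; 'X^3; 'X^2; 'X^2; 'X^2; 'X^2;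
              'X; 'X^2; 'X^2; 'X; 'X; 'X] i.

Definition dotp (n : nat) (u v : 'cV[{poly int}]_n) : {poly int} :=
  \sum_(i < n) u i 0 * v i 0.

(* Main.v *)
Require Import Defs.
From mathcomp Require Import all_boot all_order all_algebra all_fingroup.
Set Implicit Arguments.
Unset Strict Implicit.
Unset Printing Implicit Defensive.
Import GRing.Theory.
Local Open Scope ring_scope.

(** Closing a tangle commutes with smoothing its crossings.  Closing a
    crossingless tangle S with pairing p keeps the loops of S and creates one
    loop for each class of endpoints under the relation generated by p and the
    closing arcs.  So the bracket of the closure is the value at the bracket of
    the tangle of a Z[x]-linear functional, which depends only on the closing
    arcs; the entries of [Xbar] are its values at the tangles g_i. *)

(** * Counting the classes of an equivalence relation *)

Definition classes (U : finType) (e : rel U) : {set {set U}} :=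
  [set [set y | connect e x y] | x : U].

Lemma class_eq (U : finType) (e : rel U) x y : connect_sym e ->
  ([set z | connect e x z] == [set z | connect e y z]) = connect e x y.
Proof.
move=> sym; apply/eqP/idP => [/setP/(_ y)|xy]; first by rewrite !inE connect0.
by apply/setP => z; rewrite !inE (same_connect sym xy).
Qed.

(** Both images are projections of the set of pairs [(f x, h x)], and the hypothesis makes both
    projections injective on it. *)
Lemma card_imset_eq (U X Y : finType) (f : U -> X) (h : U -> Y) :
  (forall x y, (f x == f y) = (h x == h y)) ->
  #|[set f x | x : U]| = #|[set h x | x : U]|.
Proof.
move=> fh; pose P := [set (f x, h x) | x : U].
have -> : [set f x | x : U] = fst @: P by rewrite -imset_comp.
have -> : [set h x | x : U] = snd @: P by rewrite -imset_comp.
rewrite (card_in_imset (f := fst)) ?(card_in_imset (f := snd)) //.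
  move=> _ _ /imsetP[x _ ->] /imsetP[y _ ->] /= E; congr (_, _) => //.
  by apply/eqP; rewrite fh E.
move=> _ _ /imsetP[x _ ->] /imsetP[y _ ->] /= E; congr (_, _) => //.
by apply/eqP; rewrite -fh E.
Qed.

Lemma card_classes (U X : finType) (e : rel U) (f : U -> X) :
  connect_sym e -> (forall x y, (f x == f y) = connect e x y) ->
  #|[set f x | x : U]| = #|classes e|.
Proof. by move=> sym fe; apply: card_imset_eq => x y; rewrite fe class_eq. Qed.

(** This form suits [link], which is not symmetric: a [node] step is undone by three further [node]
    steps. *)
Lemma connect_symW (U : finType) (e : rel U) :
  (forall x y, e x y -> connect e y x) -> connect_sym e.
Proof.
move=> back; suff H x y : connect e x y -> connect e y x.
  by move=> x y; apply/idP/idP; apply: H.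
case/connectP => p; elim: p x => [|z p IH] x /=; first by move=> _ ->.
by case/andP => /back zx pz yl; apply: connect_trans zx; apply: IH.
Qed.

(** * Regular diagrams and their smoothings *)

(* Weaker than [diagram], but stable under smoothing and concatenation. *)
Definition regular (B : finType) (D : shadow B) : Prop :=
  [/\ involutive (edge D), injective (endp D),
      forall b, node D (endp D b) = endp D b & period4 D].

Lemma diagram_regular (B : finType) (D : shadow B) : diagram D -> regular D.
Proof.
case=> inv _ inj fixed per; split=> // b.
by apply/eqP; rewrite fixed codom_f.
Qed.

Lemma linkE (B : finType) (D : shadow B) d e :
  link D d e = (e == edge D d) || (e == node D d).
Proof. by []. Qed.

Lemma connect_link_sym (B : finType) (D : shadow B) :
  regular D -> connect_sym (link D).
Proof.
case=> inv _ _ per; apply: connect_symW => x y /orP[] /eqP ->.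
  by apply: connect1; rewrite linkE inv eqxx.
have step z : connect (link D) z (node D z).
  by apply: connect1; rewrite linkE eqxx orbT.
rewrite -{2}(per x) /=; apply: connect_trans (step _).
exact: connect_trans (step _).
Qed.

(** An endpoint is fixed by [node], so the [node]-cycle through it is a single dart, whereas a
    crossing has [node (node d) != d]. *)
Lemma endp_vertex (B : finType) (D : shadow B) d b :
  regular D -> crossing D d -> endp D b \notin vertex d.
Proof.
case=> _ _ fixed per cd; apply: contraL cd => bd; rewrite /= negbK.
have := per d; have := fixed b.
move: bd; rewrite !inE => /or4P[] /eqP -> /= F; rewrite !F // => E; rewrite ?E //.
by rewrite E in F; rewrite !F.
Qed.

Lemma regular_smooth (B : finType) (D : shadow B) d :
  regular D -> crossing D d -> regular (smooth D d).
Proof.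
move=> reg cd; case: (reg) => inv inj fixed per; split=> //.
  move=> b; rewrite (smoothD (e := endp D b) per) ?fixed //.
  exact: endp_vertex.
exact: period4_smooth.
Qed.

(** * Splicing endpoints and resolving crossings *)

Lemma node_splice_endp (B B' : finType) (D : shadow B) sigma (r : B' -> B) b :
  injective (endp D) -> node (splice D sigma r) (endp D b) = endp D (sigma b).
Proof.
move=> inj; rewrite ffunE; case: pickP => [c /eqP/inj -> //|/(_ b)].
by rewrite eqxx.
Qed.

Lemma node_splice (B B' : finType) (D : shadow B) sigma (r : B' -> B) d :
  d \notin codom (endp D) -> node (splice D sigma r) d = node D d.
Proof.
move=> dB; rewrite ffunE; case: pickP => // b /eqP bd.
by rewrite -bd codom_f in dB.
Qed.

Lemma node_notin_codom (B : finType) (D : shadow B) d :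
  regular D -> d \notin codom (endp D) -> node D d \notin codom (endp D).
Proof.
case=> _ _ fixed per; apply: contra => /codomP[b E]; apply/codomP; exists b.
by apply: (node_inj per); rewrite E fixed.
Qed.

Section Splice.
Variables (B B' : finType) (sigma : B -> B) (r : B' -> B).
Hypothesis sigmaK : involutive sigma.
Hypothesis r_inj : injective r.
Hypothesis r_fixed : forall b, sigma (r b) = r b.
Implicit Type D : shadow B.

(** As [sigma] is an involution, each spliced vertex has degree at most 2. Hence splicing creates no
    crossing. *)
Lemma splice_node2 D d : regular D ->
  node (splice D sigma r) (node (splice D sigma r) d)
  = if d \in codom (endp D) then d else node D (node D d).
Proof.
move=> reg; case: (reg) => _ inj _ _; case: ifPn => [/codomP[b ->]|dB].
  by rewrite !node_splice_endp // sigmaK.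
by rewrite (node_splice _ _ dB) node_splice ?node_notin_codom.
Qed.

Lemma regular_splice D : regular D -> regular (splice D sigma r).
Proof.
move=> reg; case: (reg) => inv inj fixed per; split=> //.
- by move=> b c /inj/r_inj.
- by move=> b; rewrite [endp _ _]/(endp D (r b)) node_splice_endp // r_fixed.
move=> d; rewrite !iterS !splice_node2 // [iter 0 _ _]/=.
case: (boolP (d \in codom (endp D))) => dB; first by rewrite dB.
by rewrite ifN ?node_notin_codom //; apply: (per d).
Qed.

Lemma crossing_splice D : regular D -> crossing (splice D sigma r) =1 crossing D.
Proof.
move=> reg d; case: (reg) => _ inj fixed _.
rewrite !crossing_def splice_node2 //.
by case: ifP => // /codomP[b ->]; rewrite !fixed !eqxx.
Qed.

(** Smoothing composes [node] with a transposition of two darts at a crossing. Neither is an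
    endpoint, so the values changed by splicing are left alone. *)
Lemma smooth_splice D d : regular D -> crossing D d ->
  smooth (splice D sigma r) d = splice (smooth D d) sigma r.
Proof.
move=> reg cd; case: (reg) => _ inj fixed per.
have dB : d \notin codom (endp D).
  by apply: contra cd => /codomP[b ->]; rewrite !fixed.
have dE x : x \in codom (endp D) -> tperm d (node D (node D d)) x = x.
  move=> xB; rewrite tpermD //; apply: contraTneq xB => <- //.
  by rewrite !node_notin_codom.
rewrite /smooth splice_node2 // (negPf dB); congr Shadow.
apply/ffunP => e; rewrite !ffunE /=; case: pickP => [b _|//].
by rewrite dE ?codom_f.
Qed.

(** Both diagrams have the same darts and the same crossings, so [pick] selects the same crossing in
    each; the two resolution trees run in parallel and only their leaves need comparing. *)
Lemma skein_splice (M : nmodType) (v : shadow B' -> M) (w : shadow B -> M) D :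
  (forall S, regular S -> v (splice S sigma r) = w S) ->
  regular D -> skein v (splice D sigma r) = skein w D.
Proof.
move=> vw reg; rewrite /skein (eq_card (crossing_splice reg)).
move: #|crossing D| => k; elim: k D reg => [|k IH] D reg /=; first exact: vw.
rewrite (eq_pick (crossing_splice reg)); case: pickP => [d cd|_]; last exact: vw.
case: (reg) => _ _ _ per.
have cnd : crossing D (node D d) by rewrite crossing_node.
have dB : d \notin codom (endp D).
  by case: (reg) => _ _ fixed _; apply: contra cd => /codomP[b ->]; rewrite !fixed.
by rewrite node_splice // !smooth_splice // !IH //; apply: regular_smooth.
Qed.

End Splice.

Lemma loops_void (D : shadow void) : loops D = #|components D|.
Proof.
apply: eq_card => C; rewrite inE andb_idr // => _.
by rewrite disjoint_sym disjoint_subset; apply/subsetP => x /codomP[[]].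
Qed.

(** * Components of a closed diagram *)

Section Closing.
Variables (B : finType) (sigma : B -> B).
Hypothesis sigmaK : involutive sigma.
Implicit Type D : shadow B.

(** One step follows either a closing arc or a strand of the tangle, the latter seen only through
    the block of [p] containing its ends. *)
Definition glue (p : {set {set B}}) : rel B :=
  [rel b c | (c == sigma b) || [exists C in p, (b \in C) && (c \in C)]].

Lemma glue_sym p : connect_sym (glue p).
Proof.
apply: sym_connect_sym => b c; rewrite /glue /=; congr (_ || _).
  by rewrite -(inj_eq (inv_inj sigmaK)) sigmaK eq_sym.
by apply: eq_existsb => C; rewrite (andbC (b \in C)).
Qed.

Let closing D : shadow void := splice D sigma (@of_void B).

Lemma regular_closing D : regular D -> regular (closing D).
Proof. by apply: regular_splice => // -[]. Qed.

Lemma connect_pairing D b c : regular D ->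
  connect (link D) (endp D b) (endp D c)
  = [exists C in pairing D, (b \in C) && (c \in C)].
Proof.
move=> reg; have sym := connect_link_sym reg.
apply/idP/exists_inP => [bc|[_ /imsetP[a _ ->]]].
  by exists [set c | connect (link D) (endp D b) (endp D c)];
     rewrite ?imset_f // !inE connect0.
by rewrite !inE => /andP[ab ac]; apply: connect_trans ac; rewrite sym.
Qed.

(** Closing changes [node] only at endpoints, where the old [node] step was stationary. *)
Lemma connect_closing D x y : regular D ->
  connect (link D) x y -> connect (link (closing D)) x y.
Proof.
move=> reg; apply: connect_sub => {}x {}y /orP[] /eqP ->.
  by apply: connect1; rewrite linkE eqxx.
case: (reg) => _ inj fixed _.
have [/codomP[b ->]|xB] := boolP (x \in codom (endp D)).
  by rewrite fixed.
by apply: connect1; rewrite linkE (node_splice _ _ xB) eqxx orbT.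
Qed.

Lemma connect_glue D b c : regular D -> connect (glue (pairing D)) b c ->
  connect (link (closing D)) (endp D b) (endp D c).
Proof.
move=> reg /connectP[p]; elim: p b => [|a p IH] b /=; first by move=> _ ->.
case/andP=> ba pa cl; apply: connect_trans (IH _ pa cl).
case/orP: ba => [/eqP ->|]; last first.
  by rewrite -connect_pairing //; apply: connect_closing.
case: (reg) => _ inj _ _.
by apply: connect1; rewrite linkE (node_splice_endp _ _ _ inj) eqxx orbT.
Qed.

(** A path that uses closing arcs is cut at its first and last endpoint; in between, it alternates
    between arcs and strands, which is a path for [glue]. *)
Lemma connect_closingP D x y : regular D ->
  connect (link (closing D)) x y ->
  connect (link D) x y \/
  exists b c, [/\ connect (link D) x (endp D b), connect (glue (pairing D)) b c
                & connect (link D) (endp D c) y].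
Proof.
move=> reg; case: (reg) => _ inj _ _.
pose Q z := connect (link D) z y \/
  exists b c, [/\ connect (link D) z (endp D b), connect (glue (pairing D)) b c
                & connect (link D) (endp D c) y].
rewrite -/(Q x); case/connectP => p; elim: p x => [|z p IH] x /=.
  by move=> _ E; left; rewrite E connect0.
case/andP=> xz pz yl; have {IH} := IH _ pz yl.
have prepend : connect (link D) x z -> Q z -> Q x.
  move=> cxz [zy|[b [c [zb bc cy]]]]; first by left; apply: connect_trans zy.
  by right; exists b, c; split=> //; apply: connect_trans zb.
case/orP: xz => [/eqP E|/eqP].
  by apply: prepend; apply: connect1; rewrite linkE E eqxx.
have [/codomP[b ->]|xB] := boolP (x \in codom (endp D)); last first.
  rewrite (node_splice _ _ xB) => E.
  by apply: prepend; apply: connect1; rewrite linkE E eqxx orbT.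
rewrite (node_splice_endp _ _ _ inj) => ->.
have step : connect (glue (pairing D)) b (sigma b).
  by apply: connect1; rewrite /glue /= eqxx.
move=> {prepend} [zy|[a [c [za ac cy]]]]; right.
  by exists b, (sigma b); split.
(* The arc from [b] to [sigma b] is followed by the strand from [sigma b] to [a], then by the path
   already found. *)
exists b, c; split=> //; apply: connect_trans step _; apply: connect_trans ac.
by apply: connect1; rewrite /glue /= -connect_pairing // za orbT.
Qed.

Lemma connect_closing_endp D b c : regular D ->
  connect (link (closing D)) (endp D b) (endp D c)
  = connect (glue (pairing D)) b c.
Proof.
move=> reg; have G a a' : connect (link D) (endp D a) (endp D a') ->
    connect (glue (pairing D)) a a'.
  by rewrite connect_pairing // => H; apply: connect1; rewrite /glue /= H orbT.
apply/idP/idP => [/connect_closingP[]// |]; [exact: G| |exact: connect_glue].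
case=> a [a' [/G ba aa' /G]]; apply: connect_trans.
exact: connect_trans aa'.
Qed.

Lemma closing_class D x : regular D ->
  (forall b, ~~ connect (link D) x (endp D b)) ->
  [set y | connect (link (closing D)) x y] = [set y | connect (link D) x y].
Proof.
move=> reg xB; apply/setP => y; rewrite !inE; apply/idP/idP.
  by case/connect_closingP => // -[b [c [xb _ _]]]; have := xB b; rewrite xb.
exact: connect_closing.
Qed.

Lemma disjoint_codomP (D : shadow B) (C : {set dart D}) :
  reflect (forall b, endp D b \notin C) [disjoint C & codom (endp D)].
Proof.
rewrite disjoint_sym disjoint_subset; apply: (iffP subsetP) => H.
  by move=> b; apply: H; apply: codom_f.
by move=> _ /codomP[b ->]; apply: H.
Qed.

Lemma loops_closing D : regular D ->
  loops (closing D) = (loops D + #|classes (glue (pairing D))|)%N.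
Proof.
move=> reg; have symS := connect_link_sym (regular_closing reg).
rewrite loops_void.
(* Components of the closure are split by whether they avoid all endpoints: those that do are the
   old loops, the others correspond to the classes of [glue]. *)
pose free := [set C : {set dart D} | [disjoint C & codom (endp D)]].
rewrite -(cardsID free (components (closing D))); congr (_ + _)%N.
  have E x : [disjoint [set y | connect (link D) x y] & codom (endp D)] ->
      [set y | connect (link (closing D)) x y] = [set y | connect (link D) x y].
    move=> /disjoint_codomP H; apply: closing_class => // b.
    by have := H b; rewrite inE.
  apply: eq_card => C; rewrite !inE.
  apply/andP/andP => -[/imsetP[x _ ->]] dis; last first.
    by have e := E x dis; rewrite -e in dis *; split=> //; rewrite imset_f.
  (* The component of [x] in [D] lies inside its component in the closure, so it also avoids the
     endpoints. *)
  have {}E : [set y | connect (link (closing D)) x y] = [set y | connect (link D) x y].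
    apply: E; apply: disjointWl dis; apply/subsetP => y; rewrite !inE.
    exact: connect_closing.
  by rewrite E in dis *; split=> //; rewrite imset_f.
rewrite -(@card_classes _ _ _
  (fun b => [set y | connect (link (closing D)) (endp D b) y])); first last.
- by move=> b c; rewrite class_eq // connect_closing_endp.
- exact: glue_sym.
apply: eq_card => C; rewrite !inE; apply/andP/imsetP => [[dis /imsetP[x _ E]]|].
  move: dis; rewrite {}E => /disjoint_codomP H.
  have [b xb] : exists b, connect (link (closing D)) x (endp D b).
    apply/existsP; apply: contra_notT H => /existsPn H b.
    by rewrite inE.
  by exists b => //; apply/eqP; rewrite class_eq.
case=> b _ ->; split; last by rewrite imset_f.
by apply/negP => /disjoint_codomP/(_ b); rewrite inE connect0.
Qed.

(** * The linear functional from tangle brackets to brackets of closures *)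

Definition contract (f : {ffun {set {set B}} -> {poly int}^o}) : {poly int} :=
  \sum_p f p * 'X^#|classes (glue p)|.

Lemma contract_linear a f h :
  contract (a *: f + h) = a * contract f + contract h.
Proof.
rewrite /contract mulr_sumr -big_split.
by apply: eq_bigr => p _; rewrite !ffunE /= mulrDl mulrA.
Qed.

Lemma skein_contract (v : shadow B -> {ffun {set {set B}} -> {poly int}^o}) D :
  contract (skein v D) = skein (contract \o v) D.
Proof.
rewrite /skein; move: #|_| => k; elim: k D => //= k IH D; case: pickP => // d _.
(* Additivity is the case of scalar 1 in [contract_linear]. *)
by rewrite -!IH -[X in X + _]scale1r contract_linear mul1r.
Qed.

Lemma closed_bracket_closing D : regular D ->
  closed_bracket (closing D) = contract (tangle_bracket D).
Proof.
move=> reg; rewrite skein_contract; apply: skein_splice => // [S regS].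
(* At a leaf only the term of its own pairing survives; the exponents of the loops and of the glued
   classes add up as in [loops_closing]. *)
rewrite /= /contract (bigD1 (pairing S)) //= big1 ?addr0 => [|p /negPf neq].
  by rewrite ffunE eqxx -exprD -loops_closing.
by rewrite ffunE neq mul0r.
Qed.

End Closing.

Lemma regular_concat (S T : shadow endpoint) :
  regular S -> regular T -> regular (concat S T).
Proof.
move=> [iS jS fS pS] [iT jT fT pT]; apply: regular_splice.
- by do 3 case.
- by move=> [i|i] [j|j] // [->].
- by case.
split.
- by case=> d; rewrite !ffunE ?iS ?iT.
- by move=> [b|b] [c|c] //= [] => [/jS|/jT] ->.
- by case=> b; rewrite ffunE /= ?fS ?fT.
by case=> d; rewrite /= !ffunE; congr (_ _); [exact: pS | exact: pT].
Qed.

(** * The closures of the 14 basis tangles, by computation *)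

Definition opposite (b : endpoint) : endpoint :=
  match b with inl i => inr i | inr i => inl i end.

Lemma oppositeK : involutive opposite.
Proof. by case. Qed.

Definition endpoints : seq endpoint := [:: t1; t2; t3; t4; b1; b2; b3; b4].

Lemma mem_endpoints b : b \in endpoints.
Proof. by case: b => -[[|[|[|[|k]]]] lt]. Qed.

(** A form of the product of transpositions in [chords] that evaluates; the fold runs left to right,
    as permutations compose here. *)
Definition mate (s : seq (endpoint * endpoint)) (b : endpoint) : endpoint :=
  foldl (fun c p => if c == p.1 then p.2 else if c == p.2 then p.1 else c) b s.

Lemma edge_chords s b : edge (chords s) b = mate s b.
Proof.
rewrite ffunE; elim: s b => [|p s IH] b; first by rewrite big_nil perm1.
rewrite big_cons permM IH /=; congr mate.
by case: tpermP => [->|->|/eqP/negPf -> /eqP/negPf ->]; rewrite ?eqxx //; case: eqP.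
Qed.

Definition lower (b c : endpoint) : endpoint :=
  if (index b endpoints <= index c endpoints)%N then b else c.

(* The endpoint of least position in [endpoints] at distance at most [k] from
   [b] in the closure of [chords s].  A curve of this closure passes through at
   most 8 endpoints, so [k = 4] reaches all of them. *)
Fixpoint least (s : seq (endpoint * endpoint)) (k : nat) (b : endpoint) :=
  if k is k'.+1 then
    lower (least s k' b)
      (lower (least s k' (mate s b)) (least s k' (opposite b)))
  else b.

Lemma least_connect s k b :
  connect (link (tangle_closure (chords s))) b (least s k b).
Proof.
have node_op c : node (tangle_closure (chords s)) c = opposite c.
  by rewrite (@node_splice_endp _ _ (chords s) _ _ c).
elim: k b => [|k IH] b /=; first exact: connect0.
have lowerP x y e : connect e b x -> connect e b y -> connect e b (lower x y).
  by rewrite /lower; case: ifP.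
apply: (lowerP); first exact: IH.
apply: lowerP; apply: connect_trans (IH _).
all: by apply: connect1; rewrite linkE -?edge_chords ?node_op eqxx ?orbT.
Qed.

Lemma regular_chords s : involutive (mate s) -> regular (chords s).
Proof.
move=> sK; split=> // b; [|by rewrite ffunE | by rewrite /= !ffunE].
by rewrite !edge_chords sK.
Qed.

(** [least s k b] lies in the component of [b], and by the hypotheses it is constant along links; so
    it is a complete invariant of components, and its distinct values count them. *)
Lemma card_components_closure_chords s k : involutive (mate s) ->
  (forall b, least s k (mate s b) = least s k b) ->
  (forall b, least s k (opposite b) = least s k b) ->
  #|components (tangle_closure (chords s))|
  = size (undup (map (least s k) endpoints)).
Proof.
move=> sK mateE oppE.
have sym : connect_sym (link (tangle_closure (chords s))).
  apply: connect_link_sym; apply: regular_closing; first exact: oppositeK.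
  exact: regular_chords.
rewrite -[components _]/(classes _) -(@card_classes _ _ _ (least s k) sym).
  rewrite -(card_uniqP (undup_uniq (map _ _))); apply: eq_card => b.
  by rewrite mem_undup; apply/imsetP/mapP => -[c _ ->]; exists c;
     rewrite ?mem_endpoints.
move=> b c; apply/eqP/idP => [E|].
  by rewrite (same_connect sym (@least_connect s k b)) E sym least_connect.
case/connectP => p; elim: p b => [|a p IH] b /=; first by move=> _ ->.
case/andP=> ba pa cl; rewrite -(IH _ pa cl).
case/orP: ba => /eqP ->; first by rewrite [edge _ _]edge_chords mateE.
by rewrite (@node_splice_endp _ _ (chords s) _ _ b) // oppE.
Qed.

(** Besides checking that each chord list gives an involution, this certifies that depth 4 suffices
    for [least] to be constant on every component. *)
Definition chord_table : bool :=
  all (fun s => all (fun b => [&& mate s (mate s b) == b,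
      least s 4 (mate s b) == least s 4 b &
      least s 4 (opposite b) == least s 4 b]) endpoints) g_chords.

Lemma chord_tableP (i : 'I_14) b (s := nth [::] g_chords i) :
  [/\ mate s (mate s b) = b, least s 4 (mate s b) = least s 4 b
    & least s 4 (opposite b) = least s 4 b].
Proof.
have si : s \in g_chords by apply: mem_nth; apply: ltn_ord.
have /allP/(_ s si)/allP/(_ b (mem_endpoints b)) : chord_table by vm_compute.
by case/and3P => /eqP ? /eqP ? /eqP ?.
Qed.

Lemma regular_g i : regular (g i).
Proof. by apply: regular_chords => b; have [] := chord_tableP i b. Qed.

Lemma closed_bracket_closure_g i : closed_bracket (tangle_closure (g i)) = Xbar i 0.
Proof.
rewrite /closed_bracket /skein.
have -> : #|crossing (tangle_closure (g i))| = 0%N.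
  rewrite (eq_card (crossing_splice (r := @of_void _) oppositeK (regular_g i))).
  by apply: eq_card0 => d; rewrite -[LHS]/(crossing (g i) d) crossing_def !ffunE eqxx.
rewrite [resolve _ _ _]/= loops_void.
rewrite (@card_components_closure_chords _ 4) ?mxE;
  try by move=> b; have [] := chord_tableP i b.
(* These are the exponents of [x] in [Xbar]. *)
have -> : size (undup (map (least (nth [::] g_chords i) 4) endpoints))
    = nth 0%N [:: 4; 3; 3; 3; 2; 2; 2; 2; 1; 2; 2; 1; 1; 1]%N i.
  by apply/eqP; case: i => m lt; do 14?[case: m lt => [|m] lt; first by vm_compute].
by case: i => m lt; do 14?[case: m lt => [|m] lt; first by rewrite /= ?expr1].
Qed.

Lemma regular_tangle_power T n : regular T -> regular (tangle_power T n).
Proof.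
move=> reg; rewrite /tangle_power; case: n => [|n]; first exact: regular_g.
by rewrite iteropS; elim: n => //= n IH; apply: regular_concat.
Qed.

Theorem theorem4 (T : shadow endpoint) (n : nat) (A : 'cV[{poly int}]_14) :
  tangle4 T ->
  is_bracket_vector (tangle_power T n) A ->
  closed_bracket (tangle_closure (tangle_power T n)) = dotp A Xbar.
Proof.
case=> /diagram_regular reg _ TA.
rewrite (closed_bracket_closing oppositeK (regular_tangle_power n reg)) TA.
have contract0 : contract opposite 0 = 0.
  by rewrite /contract big1 // => p _; rewrite ffunE mul0r.
rewrite /dotp; elim/big_rec2: _ => [|i y f _ IH]; first exact: contract0.
(* [contract] is moved through the sum one term at a time; on the bracket of [g i] it is the bracket
   of the closure of [g i], hence the entry of [Xbar]. *)
rewrite contract_linear IH -closed_bracket_closing ?closed_bracket_closure_g //.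
  exact: oppositeK.
exact: regular_g.
Qed.
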